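(* Let $\rho = (1,k-1,1)$. For every integer $k \geq 1$, $$C_{3,4}^k = \vert \mathbb{S}(4^3,\rho) \vert = \frac{256 k^6 - 114 k^5 + 217 k^4 - 12 k^3 + 121 k^2}{36} + 1.$$
   Context: $n^3$ denotes the three-row rectangular shape $(n,n,n)$. The Young diagram of shape $\lambda=(\lambda_1,\dots,\lambda_m)$ is the left-justified array with $\lambda_i$ cells in the $i$-th row from the top; $(i,j)$ is the cell in row $i$, column $j$. $\mathbb{S}(\lambda,\rho)$ is the set of standard set-valued Young tableaux of shape $\lambda$ and row-constant density $\rho=(\rho_1,\dots,\rho_m)$: assignments of the integers $1,\dots,M$, $M=\sum_i\lambda_i\rho_i$, to the cells so that each cell in row $i$ receives precisely $\rho_i$ integers (unordered within the cell), and for each cell $(i,j)$ every integer in it is smaller than every integer in the cells $(i+1,j)$ and $(i,j+1)$. In the degenerate case $k=1$ the middle-row cells are empty and the tableaux are identified with standard Young tableaux formed by the first and third rows, i.e. the order condition is read as: every integer in cell $(i,j)$ is smaller than every integer in any other cell $(i',j')$ with $i'\ge i$, $j'\ge j$ (for positive densities this is equivalent to the condition above). The numbers $C^k_{3,n} := \vert \mathbb{S}(n^3,\rho)\vert$ with $\rho=(1,k-1,1)$ are called the three-dimensional $k$-Catalan numbers. *)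

(* Defs.v *)
From mathcomp Require Import all_boot all_order all_algebra.

Set Implicit Arguments.
Unset Strict Implicit.
Unset Printing Implicit Defensive.

Section SetValuedTableaux.

Variables (m : nat) (lam rho : m.-tuple nat).

(* Rows and columns are numbered from 0. *)
Definition cell := {i : 'I_m & 'I_(tnth lam i)}.

Definition row_of (c : cell) : nat := tag c.
Definition col_of (c : cell) : nat := tagged c.

Definition num_labels : nat := \sum_(i < m) tnth lam i * tnth rho i.

(* The integers 1, ..., M are represented by 'I_M, shifted down by 1; a filling
   sends each integer to the cell containing it. *)
Definition filling := {ffun 'I_num_labels -> cell}.

Definition content (T : filling) (c : cell) : {set 'I_num_labels} :=
  [set x | T x == c].

Definition has_density (T : filling) : bool :=
  [forall c : cell, #|content T c| == tnth rho (tag c)].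

(* The order condition is imposed on all comparable pairs of distinct cells
   rather than on neighbouring cells only, so that it stays meaningful across
   rows of density 0.  For a partition shape and positive densities the two
   conditions agree: see [standard_adjacentE] below. *)
Definition standard (T : filling) : bool :=
  [forall c : cell, forall d : cell,
    [&& c != d, row_of c <= row_of d & col_of c <= col_of d] ==>
    [forall x in content T c, forall y in content T d, x < y]].

Definition set_valued_tableaux : {set filling} :=
  [set T | has_density T && standard T].

Definition adjacent (c d : cell) : bool :=
  ((row_of d == (row_of c).+1) && (col_of d == col_of c)) ||
  ((row_of d == row_of c) && (col_of d == (col_of c).+1)).

Definition adjacent_standard (T : filling) : bool :=
  [forall c : cell, forall d : cell, adjacent c d ==>
    [forall x in content T c, forall y in content T d, x < y]].

Lemma cell_inj (c d : cell) : row_of c = row_of d -> col_of c = col_of d -> c = d.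
Proof.
case: c d => [i j] [i' j'] /val_inj /= ii'; subst i'.
by move=> /val_inj /= ->.
Qed.

Lemma standard_adjacentE (T : filling) :
  (forall i j : 'I_m, i <= j -> tnth lam j <= tnth lam i) ->
  (forall i : 'I_m, 0 < tnth rho i) ->
  has_density T -> standard T = adjacent_standard T.
Proof.
move=> lamP rho_gt0 /forallP dT.
apply/forallP/forallP => [sT c|aT].
  apply/forallP => d; apply/implyP => acd.
  apply: (implyP (forallP (sT c) d)); case/orP: acd => /andP[/eqP r /eqP s].
    rewrite r s leqnn leqnSn !andbT; apply/eqP => e.
    by move: r; rewrite e => /n_Sn.
  rewrite r s leqnn leqnSn !andbT; apply/eqP => e.
  by move: s; rewrite e => /n_Sn.
have step c d x y : adjacent c d -> T x = c -> T y = d -> x < y.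
  move=> acd Tx Ty; have /forall_inP/(_ x) := implyP (forallP (aT c) d) acd.
  rewrite inE Tx eqxx => /(_ isT)/forall_inP/(_ y).
  by rewrite inE Ty eqxx => /(_ isT).
have main n : forall c d x y, row_of d + col_of d <= n -> c != d ->
    row_of c <= row_of d -> col_of c <= col_of d ->
    T x = c -> T y = d -> x < y.
  elim: n => [|n IHn] c d x y dn ncd rcd ccd Tx Ty.
    case/eqP: ncd; move: dn; rewrite leqn0 addn_eq0 => /andP[/eqP r /eqP s].
    by apply: cell_inj; apply/eqP;
       [move: rcd; rewrite r leqn0 | move: ccd; rewrite s leqn0].
  have [e [eld rce cce aed]] : exists e : cell,
     [/\ row_of e + col_of e <= n, row_of c <= row_of e,
         col_of c <= col_of e & adjacent e d].
    have [ltc|gec] := ltnP (col_of c) (col_of d).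
      case: d dn rcd ltc {ncd ccd Ty} => i j; rewrite /row_of /col_of /= => dn rcd ltc.
      have j0 : 0 < j := leq_ltn_trans (leq0n _) ltc.
      have lj : j.-1 < tnth lam i := leq_ltn_trans (leq_pred _) (ltn_ord j).
      exists (Tagged (fun i => 'I_(tnth lam i)) (Ordinal lj)).
      rewrite /adjacent /row_of /col_of /= prednK // !eqxx orbT; split=> //.
        by move: dn; rewrite -{1}(prednK j0) addnS ltnS.
      by rewrite -ltnS prednK.
    have ecd : col_of c = col_of d by apply/eqP; rewrite eqn_leq ccd gec.
    have ltr : row_of c < row_of d.
      rewrite ltn_neqAle rcd andbT; apply/eqP => e.
      by case/eqP: ncd; apply: cell_inj.
    case: d dn ltr ecd {ncd rcd ccd gec Ty} => i j; rewrite /row_of /col_of /=.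
    move=> dn ltr ecd.
    have i0 : 0 < i := leq_ltn_trans (leq0n _) ltr.
    have li : i.-1 < m := leq_ltn_trans (leq_pred _) (ltn_ord i).
    have lj : j < tnth lam (Ordinal li).
      by apply: leq_trans (ltn_ord j) _; apply: lamP; rewrite /= leq_pred.
    exists (Tagged (fun i => 'I_(tnth lam i)) (Ordinal lj)).
    rewrite /adjacent /row_of /col_of /= prednK // !eqxx; split=> //.
    - by move: dn; rewrite -{1}(prednK i0) addSn ltnS.
    - by rewrite -ltnS prednK.
    - by rewrite ecd.
  have [ce|nce] := eqVneq c e; first by subst e; apply: step aed Tx Ty.
  have : 0 < #|content T e| by rewrite (eqP (dT e)).
  case/card_gt0P => z; rewrite inE => /eqP Tz.
  exact: ltn_trans (IHn _ _ _ _ eld nce rce cce Tx Tz) (step _ _ _ _ aed Tz Ty).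
move=> c; apply/forallP => d; apply/implyP => /and3P[ncd rcd ccd].
apply/forall_inP => x; rewrite inE => /eqP Tx.
apply/forall_inP => y; rewrite inE => /eqP Ty.
exact: main (leqnn _) ncd rcd ccd Tx Ty.
Qed.

End SetValuedTableaux.

(* The three-dimensional k-Catalan number C^k_{3,n}, for k >= 1. *)
Definition catalan3 (k n : nat) : nat :=
  #|set_valued_tableaux [tuple n; n; n] [tuple 1; k - 1; 1]|.

(* Main.v *)
Require Import Defs.
From mathcomp Require Import all_boot all_order all_algebra.
From mathcomp Require Import ring zify.

(* Recording only the row of each label turns a tableau into a word, and the column of a
   label is recovered from the number of earlier labels in its row, because the cells of a
   row are filled from left to right.  The order condition becomes a ballot condition on
   the prefixes of the word, so for three rows one counts lattice paths to (a, b, c), where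
   a, b, c are the numbers of labels placed in each row.  Put K = k - 1 > 0 and
   b = j K + t with 0 <= t <= K.  For fixed j, a, c the number of paths is a polynomial in
   t and K: within a block j the recurrence on the last step is a difference equation in t,
   and consecutive blocks are glued at the multiples of K. *)

Set Implicit Arguments.
Unset Strict Implicit.
Unset Printing Implicit Defensive.

(** * Counting letters in prefixes of a word *)

(** Successive positions satisfying [p] have 0, 1, 2, ... such positions before them, so each rank
    [t] below [count p w] occurs exactly once. *)
Lemma card_count_take (A : Type) n (w : n.-tuple A) (p : pred A) (Q : pred nat) :
  #|[set x : 'I_n | p (tnth w x) && Q (count p (take x w))]| =
    \sum_(t < count p w) Q t.
Proof.
rewrite -sum1dep_card big_mkcond /=.
elim: n w Q => [|n IHn] w Q; first by rewrite tuple0 !big_ord0.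
case/tupleP: w => a w; rewrite big_ord_recl tnth0 /=.
under eq_bigr do rewrite tnthS.
have /= -> := IHn w (fun t => Q (p a + t)).
by case: (p a); rewrite //= big_ord_recl; case: (Q 0).
Qed.

Lemma count_take_card (A : Type) n (w : n.-tuple A) (p : pred A) i :
  count p (take i w) = #|[set x : 'I_n | (x < i) && p (tnth w x)]|.
Proof.
rewrite -sum1dep_card big_mkcond /=.
elim: n w i => [|n IHn] w i; first by rewrite tuple0 big_ord0.
case/tupleP: w => a w; rewrite big_ord_recl tnth0 /=.
case: i => [|i] /=; first by rewrite big1.
under [X in _ = _ + X]eq_bigr do rewrite tnthS.
by rewrite IHn; case: (p a).
Qed.

(** The ranks with quotient [j] form one block of [r] consecutive integers. With [card_count_take]
    this gives the density of a cell in the tableau rebuilt from a word. *)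
Lemma sum_divn_eq l r j : j < l -> \sum_(t < l * r) (t %/ r == j) = r.
Proof.
case: r => [|r] jl; first by rewrite muln0 big_ord0.
rewrite -(big_mkord xpredT (fun t => (t %/ r.+1 == j) : nat)) big_nat_mul.
under eq_big_nat => i _.
  rewrite (eq_big_nat _ _ (F2 := fun=> (i == j) : nat)) => [|t /andP[t1 t2]].
    rewrite sum_nat_const_nat mulSn addnK; over.
  have -> // : t %/ r.+1 = i.
  by apply/eqP; rewrite eqn_leq leq_divRL // t1 andbT -ltnS ltn_divLR.
rewrite big_mkord (bigD1 (Ordinal jl)) //= eqxx muln1 big1 ?addn0 // => i.
by rewrite -val_eqE /= => /negPf->; rewrite muln0.
Qed.

(** * Bijection between tableaux and ballot words *)

Section RowWords.

Variables (m : nat) (lam rho : m.-tuple nat).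

Local Notation M := (num_labels lam rho).
Local Notation row T x := (tag ((T : filling lam rho) x)).
Local Notation col T x := (col_of ((T : filling lam rho) x)).

Definition row_word (T : filling lam rho) : M.-tuple 'I_m := [tuple row T x | x < M].

(** The quotient is the number of full cells in row [r]: a lower row may only use columns below
    these. All pairs of rows are compared, not just neighbours, so that the condition passes across
    a row of density 0. *)
Definition ballot (w : seq 'I_m) : bool :=
  [forall r : 'I_m, forall s : 'I_m, (r < s) && (0 < tnth rho r) ==>
    (count_mem s w <= count_mem r w %/ tnth rho r * tnth rho s)].

Definition ballot_words : {set M.-tuple 'I_m} :=
  [set w : M.-tuple 'I_m |
    [forall r, count_mem r w == tnth lam r * tnth rho r] &&
    [forall i : 'I_M.+1, ballot (take i w)]].

Lemma standardP (T : filling lam rho) :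
  reflect (forall x y, T x != T y -> row T x <= row T y -> col T x <= col T y -> x < y)
          (standard T).
Proof.
apply: (iffP forallP) => [sT x y nxy rxy cxy | sT c].
  have /forallP/(_ (T y))/implyP := sT (T x); rewrite nxy rxy cxy => /(_ isT).
  by move=> /forall_inP/(_ x); rewrite inE eqxx => /(_ isT)/forall_inP; apply; rewrite inE.
apply/forallP => d; apply/implyP => /and3P[ncd rcd ccd].
apply/forall_inP => x; rewrite inE => /eqP Tx.
by apply/forall_inP => y; rewrite inE => /eqP Ty; apply: sT; rewrite Tx Ty.
Qed.

Lemma card_row_prefix (T : filling lam rho) (r : 'I_m) j : has_density T ->
  #|[set x | (row T x == r) && (col T x < j)]| = minn j (tnth lam r) * tnth rho r.
Proof.
move=> /forallP dT; elim: j => [|j IHj].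
  by rewrite min0n mul0n; apply: eq_card0 => x; rewrite !inE andbF.
have [lj|jl] := leqP (tnth lam r) j.
  move: IHj; rewrite (minn_idPr lj) (minn_idPr (leqW lj)) => <-; apply: eq_card => x.
  rewrite !inE; case: eqP => //= rx.
  have xl : col T x < tnth lam r by rewrite -rx ltn_ord.
  by rewrite ltnS (ltnW (leq_trans xl lj)) (leq_trans xl lj).
pose c : cell lam := Tagged (fun i => 'I_(tnth lam i)) (Ordinal jl).
move: IHj; rewrite (minn_idPl jl) (minn_idPl (ltnW jl)) mulSn => <-.
rewrite -{1}(eqP (dT c)) addnC -cardsUI.
rewrite [X in _ + X]eq_card0 ?addn0 => [|x]; last first.
  by rewrite !inE; apply/negP => /andP[/andP[_ jx] /eqP xc]; move: jx; rewrite xc ltnn.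
apply: eq_card => x; rewrite !inE ltnS leq_eqVlt andb_orr orbC; congr (_ || _).
apply/andP/eqP => [[/eqP rx /eqP cx]|->]; last by rewrite eqxx.
by apply: cell_inj => //; rewrite /row_of rx.
Qed.

Lemma count_row_word (T : filling lam rho) (r : 'I_m) i :
  count_mem r (take i (row_word T)) = #|[set x : 'I_M | (x < i) && (row T x == r)]|.
Proof.
rewrite count_take_card; apply: eq_card => x.
by rewrite !inE /= tnth_mktuple.
Qed.

(** The labels before [x] in its row include all those in earlier columns, and together with [x]
    they stay within the columns up to that of [x]. Their number thus lies between two consecutive
    multiples of the density. *)
Lemma col_row_word (T : filling lam rho) x : has_density T -> standard T ->
  col T x = count_mem (row T x) (take x (row_word T)) %/ tnth rho (row T x).
Proof.
move=> dT /standardP sT; set r := row T x; rewrite count_row_word.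
have xl : col T x < tnth lam r := ltn_ord _.
have same y : row T y = r -> col T y != col T x -> (y < x) = (col T y < col T x).
  move=> ry nc; have nT : T y != T x by apply: contraNneq nc => ->.
  rewrite [RHS]ltn_neqAle nc /=; apply/idP/idP => [|cyx]; last by apply: sT; rewrite ?ry.
  move=> yx; rewrite leqNgt; apply/negP => cxy.
  have xy : x < y by apply: sT; rewrite 1?eq_sym ?ry // ltnW.
  by rewrite ltnNge (ltnW xy) in yx.
have lo : col T x * tnth rho r <= #|[set y : 'I_M | (y < x) && (row T y == r)]|.
  rewrite -{1}(minn_idPl (ltnW xl)) -(card_row_prefix r _ dT).
  apply/subset_leq_card/subsetP => y; rewrite !inE => /andP[/eqP ry cyx].
  by rewrite ry eqxx andbT same // (ltn_eqF cyx).
have hi : #|[set y : 'I_M | (y < x) && (row T y == r)]| < (col T x).+1 * tnth rho r.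
  rewrite -{1}(minn_idPl xl) -(card_row_prefix r _ dT); apply/proper_card/properP.
  split; last by exists x; rewrite !inE ?ltnn // eqxx ltnS leqnn.
  apply/subsetP => y; rewrite !inE => /andP[yx /eqP ry].
  rewrite ry eqxx ltnS /=.
  by have [->//|/(same _ ry) e] := eqVneq (col T y) (col T x); rewrite ltnW -?e.
have r0 : 0 < tnth rho r by rewrite lt0n; apply: contraTneq hi => ->; rewrite muln0.
by apply/eqP; rewrite eqn_leq leq_divRL // lo -ltnS ltn_divLR // hi.
Qed.

Lemma row_word_inj : {in set_valued_tableaux lam rho &, injective row_word}.
Proof.
move=> S T; rewrite !inE => /andP[dS sS] /andP[dT sT] eST.
have rST x : row S x = row T x.
  by rewrite -!(tnth_mktuple (fun x => row _ x)) -/(row_word _) eST.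
apply/ffunP => x; apply: cell_inj; first by rewrite /row_of rST.
by rewrite !col_row_word // rST eST.
Qed.

Hypothesis lam_part : forall i j : 'I_m, i <= j -> tnth lam j <= tnth lam i.

Lemma row_word_ballot (T : filling lam rho) :
  T \in set_valued_tableaux lam rho -> row_word T \in ballot_words.
Proof.
rewrite !inE => /andP[dT /standardP sT].
have le_row r i : #|[set x : 'I_M | (x < i) && (row T x == r)]| <= tnth lam r * tnth rho r.
  rewrite -{1}(minnn (tnth lam r)) -(card_row_prefix r _ dT).
  apply/subset_leq_card/subsetP => x; rewrite !inE => /andP[_ /eqP <-].
  by rewrite eqxx ltn_ord.
apply/andP; split; apply/forallP.
  move=> r; rewrite -(take_oversize (n := M) (s := row_word T)) ?size_tuple //.
  rewrite count_row_word -{1}(minnn (tnth lam r)) -(card_row_prefix r _ dT).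
  apply/eqP/eq_card => x; rewrite !inE ltn_ord /=.
  by case: eqP => //= <-; rewrite ltn_ord.
move=> i; apply/forallP => r; apply/forallP => s; apply/implyP => /andP[rs r0].
rewrite !count_row_word; set a := #|[set x : 'I_M | (x < i) && (row T x == r)]|.
(* If row [r] is already full, the partition shape alone bounds row [s]. *)
have [lq|ql] := leqP (tnth lam r) (a %/ tnth rho r).
  apply: leq_trans (le_row _ _) _.
  by rewrite leq_mul2r (leq_trans (lam_part (ltnW rs)) lq) orbT.
apply: (@leq_trans (minn (a %/ tnth rho r) (tnth lam s) * tnth rho s)); last first.
  by rewrite leq_mul2r geq_minl orbT.
rewrite -(card_row_prefix s _ dT); apply/subset_leq_card/subsetP => y.
rewrite !inE => /andP[yi /eqP sy]; rewrite sy eqxx /= ltnNge; apply/negP => qy.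
(* Otherwise the first [q + 1] cells of row [r], with [q = a %/ rho_r], are full before
   label [i]. *)
have : (a %/ tnth rho r).+1 * tnth rho r <= a.
  rewrite -{1}(minn_idPl ql) -(card_row_prefix r _ dT).
  apply/subset_leq_card/subsetP => x; rewrite !inE ltnS => /andP[/eqP rx xq].
  rewrite rx eqxx andbT (ltn_trans _ yi) // sT ?rx ?sy ?(ltnW rs) ?(leq_trans xq) //.
  by apply: contraTneq rs => Txy; rewrite -rx -sy Txy ltnn.
by rewrite leqNgt -ltn_divLR ?ltnSn.
Qed.

Lemma ballot_row_word (w : M.-tuple 'I_m) : w \in ballot_words ->
  exists2 T, T \in set_valued_tableaux lam rho & row_word T = w.
Proof.
rewrite inE => /andP[/forallP/= cw /forallP/= bw].
pose n x := count_mem (tnth w x) (take x w).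
have n_lt x : n x < tnth lam (tnth w x) * tnth rho (tnth w x).
  rewrite -(eqP (cw _)) -[X in count_mem _ X](cat_take_drop x w) count_cat.
  by rewrite -addn1 leq_add2l -has_count has_pred1 (drop_nth (tnth w x)) ?size_tuple //
       -tnth_nth mem_head.
have rho0 x : 0 < tnth rho (tnth w x).
  by have := n_lt x; case: (tnth rho _) => //; rewrite muln0.
have /fin_all_exists[T TP] x : exists c : cell lam,
    tag c = tnth w x /\ col_of c = n x %/ tnth rho (tnth w x).
  have nl : n x %/ tnth rho (tnth w x) < tnth lam (tnth w x) by rewrite ltn_divLR.
  by exists (Tagged (fun i => 'I_(tnth lam i)) (Ordinal nl)).
pose F : filling lam rho := finfun T.
have rF x : row F x = tnth w x by rewrite ffunE; case: (TP x).
have cF x : col F x = n x %/ tnth rho (tnth w x) by rewrite ffunE; case: (TP x).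
exists F; last by apply: eq_from_tnth => x; rewrite tnth_mktuple rF.
rewrite inE; apply/andP; split.
  apply/forallP => c; apply/eqP.
  rewrite -[RHS](sum_divn_eq _ (ltn_ord (tagged c))) -(eqP (cw (tag c))).
  rewrite -(card_count_take w (pred1 (tag c)) (fun t => t %/ _ == tagged c)).
  apply: eq_card => x; rewrite !inE /=; apply/eqP/andP => [<-|[/eqP wx /eqP nx]].
    by split; [rewrite rF | have := cF x; rewrite /n -rF => <-].
  apply: cell_inj; first by rewrite /row_of rF wx.
  by rewrite cF /n wx.
have take_S (y : 'I_M) : take y.+1 w = rcons (take y w) (tnth w y).
  by rewrite (take_nth (tnth w y)) ?size_tuple // -tnth_nth.
have count_le r i j : i <= j -> count_mem r (take i w) <= count_mem r (take j w).
  by move=> /minn_idPl <-; rewrite take_min; apply/leq_count_subseq/take_subseq.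
apply/standardP => x y nxy rxy cxy; rewrite ltnNge leq_eqVlt negb_or.
apply/andP; split; first by apply: contraNneq nxy => /val_inj ->.
apply/negP => yx; have [rs|] := boolP (row F x < row F y); last first.
  rewrite -leqNgt => ryx; case/eqP: nxy.
  have rE : row F x = row F y by apply/val_inj/eqP; rewrite eqn_leq rxy ryx.
  apply: cell_inj; first by rewrite /row_of rE.
  apply/eqP; rewrite eqn_leq cxy !cF -!rF rE leq_div2r // /n -!rF rE count_le //.
  exact: ltnW.
(* The prefix of length [y + 1] contains the letter at [y] itself, so the ballot inequality is
   strict for [n y]. It puts [y] in a column strictly before that of [x], against [cxy]. *)
have /forallP/(_ (tnth w x))/forallP/(_ (tnth w y))/implyP := bw (lift ord0 y).
rewrite rho0 -!rF rs !rF /= /bump add1n take_S -cats1 count_cat /= eqxx addn0 addn1.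
move=> /(_ isT); rewrite -ltn_divLR // -cF => cyx.
move: cxy; rewrite leqNgt => /negP; apply; apply: leq_trans cyx _.
by rewrite cF leq_div2r // cats1 -take_S count_le.
Qed.

Lemma card_set_valued_tableaux : #|set_valued_tableaux lam rho| = #|ballot_words|.
Proof.
rewrite -(card_in_imset row_word_inj); apply: eq_card => w.
apply/imsetP/idP => [[T sT ->]|/ballot_row_word[T sT <-]]; last by exists T.
exact: row_word_ballot.
Qed.

End RowWords.

(** * Three rows: ballot words as lattice paths *)

Lemma card_tuple_rcons (A : finType) n (P : pred (seq A)) :
  #|[set w : n.+1.-tuple A | P w]| = \sum_a #|[set w : n.-tuple A | P (rcons w a)]|.
Proof.
under eq_bigr do rewrite -sum1dep_card.
rewrite -sum1dep_card pair_big_dep /=.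
pose h (u : A * n.-tuple A) := [tuple of rcons u.2 u.1].
rewrite (reindex h) //=; apply/onW_bij/inj_card_bij.
  by move=> [a u] [b v] /(congr1 val)/rcons_inj[/val_inj -> ->].
by rewrite card_prod !card_tuple expnS.
Qed.

Lemma forall_take_rcons (A : Type) n (P : pred (seq A)) (w : n.-tuple A) a :
  [forall i : 'I_n.+2, P (take i (rcons w a))] =
    P (rcons w a) && [forall i : 'I_n.+1, P (take i w)].
Proof.
have take_w (i : 'I_n.+1) : take i (rcons w a) = take i w.
  by rewrite -cats1 takel_cat // size_tuple -ltnS.
apply/forallP/andP => [Pw | [Pwa /forallP Pw] i].
  split; first by have := Pw ord_max; rewrite take_oversize ?size_rcons ?size_tuple.
  by apply/forallP => i; have := Pw (widen_ord (leqnSn _) i); rewrite /= take_w.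
have [ni|] := ltnP n i; first by rewrite take_oversize ?size_rcons ?size_tuple.
by move=> ni; rewrite -[i : nat]/(Ordinal (ni : i < n.+1) : nat) take_w.
Qed.

Section ThreeRows.

Variable K : nat.

Definition row1 : 'I_3 := @Ordinal 3 0 isT.
Definition row2 : 'I_3 := @Ordinal 3 1 isT.
Definition row3 : 'I_3 := @Ordinal 3 2 isT.

(** The ballot condition for densities 1, [K], 1 with the division cleared. At [K = 0] it reads
    [b = 0] and [c <= a], the ballot condition for two rows. *)
Definition admissible a b c := [&& b <= a * K, c * K <= b & c <= a].

Lemma forall_I3 (P : pred 'I_3) : [forall r, P r] = [&& P row1, P row2 & P row3].
Proof.
apply/forallP/and3P => [PT|[P1 P2 P3] [[|[|[|//]]] r3]]; first by rewrite !PT.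
- by rewrite (_ : Ordinal r3 = row1) //; apply: val_inj.
- by rewrite (_ : Ordinal r3 = row2) //; apply: val_inj.
- by rewrite (_ : Ordinal r3 = row3) //; apply: val_inj.
Qed.

Lemma ballot_admissible (w : seq 'I_3) : ballot [tuple 1; K; 1] w =
  admissible (count_mem row1 w) (count_mem row2 w) (count_mem row3 w).
Proof.
rewrite /ballot !forall_I3 /= /tnth /= !divn1 !muln1 /admissible.
have [->|K0] := posnP K; first by rewrite !muln0 !andbT.
by rewrite leq_divRL // andbT -andbA; congr (_ && _); rewrite andbC.
Qed.

(** The recursion removes the last step; the path length [n] makes it structural. *)
Fixpoint walks n a b c : nat :=
  if n is n'.+1 then
    if admissible a b c then
      (if a is a'.+1 then walks n' a' b c else 0) +
      (if b is b'.+1 then walks n' a b' c else 0) +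
      (if c is c'.+1 then walks n' a b c' else 0)
    else 0
  else a + b + c == 0.

Definition ballot_words_of_content n (a b c : nat) : {set n.-tuple 'I_3} :=
  [set w : n.-tuple 'I_3 |
    [&& count_mem row1 w == a, count_mem row2 w == b & count_mem row3 w == c] &&
    [forall i : 'I_n.+1, ballot [tuple 1; K; 1] (take i w)]].

(** The ballot condition on the whole word depends only on its content; the conditions on proper
    prefixes are those of the word without its last letter. *)
Lemma card_ballot_words_of_content n (a b c : nat) :
  #|ballot_words_of_content n a b c| = walks n a b c.
Proof.
elim: n a b c => [|n IHn] a b c.
  rewrite -sum1dep_card big_mkcond (big_pred1 [tuple]) => [|w]; last first.
    by rewrite [w]tuple0 /= eqxx.
  rewrite /=; case: a b c => [|a] [|b] [|c] //=.
  by apply/eqP; rewrite eqb1; apply/forallP => i; rewrite ballot_admissible.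
pose P (s : seq 'I_3) :=
  [&& count_mem row1 s == a, count_mem row2 s == b & count_mem row3 s == c] &&
  [forall i : 'I_n.+2, ballot [tuple 1; K; 1] (take i s)].
have PE (w : n.-tuple 'I_3) r : P (rcons w r) = admissible a b c &&
    ([&& count_mem row1 (rcons w r) == a, count_mem row2 (rcons w r) == b
       & count_mem row3 (rcons w r) == c] &&
     [forall i : 'I_n.+1, ballot [tuple 1; K; 1] (take i w)]).
  rewrite /P forall_take_rcons ballot_admissible.
  by case: (@and3P (_ == a)) => [[/eqP-> /eqP-> /eqP->]|_] //=; rewrite andbF.
rewrite [LHS](card_tuple_rcons _ P) !big_ord_recl big_ord0 addn0.
under eq_finset => w do rewrite PE.
under [in X in _ + (X + _)]eq_finset => w do rewrite PE.
under [in X in _ + (_ + X)]eq_finset => w do rewrite PE.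
rewrite /=; case: admissible; last by rewrite !eq_card0 // => w; rewrite inE.
rewrite -addnA; congr (_ + (_ + _)).
- case: a {P PE} => [|a]; [apply: eq_card0 => w | rewrite -IHn; apply: eq_card => w];
    by rewrite !inE -cats1 !count_cat /= ?addn0 addn1 ?andbF.
- case: b {P PE} => [|b]; [apply: eq_card0 => w | rewrite -IHn; apply: eq_card => w];
    by rewrite !inE -cats1 !count_cat /= ?addn0 addn1 ?andbF.
- case: c {P PE} => [|c]; [apply: eq_card0 => w | rewrite -IHn; apply: eq_card => w];
    by rewrite !inE -cats1 !count_cat /= ?addn0 addn1 ?andbF.
Qed.

End ThreeRows.

Lemma catalan3_walks k n :
  catalan3 k n = walks (k - 1) (n + n * (k - 1) + n) n (n * (k - 1)) n.
Proof.
rewrite /catalan3 card_set_valued_tableaux => [|i j _]; last first.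
  have constn (r : 'I_3) : tnth [tuple n; n; n] r = n by case: r => [[|[|[|]]]].
  by rewrite !constn.
have -> : n + n * (k - 1) + n = num_labels [tuple n; n; n] [tuple 1; k - 1; 1].
  by rewrite /num_labels !big_ord_recl big_ord0 /tnth /= !muln1 addn0 addnA.
rewrite -card_ballot_words_of_content; apply: eq_card => w; rewrite !inE.
by rewrite forall_I3 /tnth /= !muln1.
Qed.

(** * Block polynomials and their identities *)

Import Order.TTheory GRing.Theory Num.Theory.
Local Open Scope ring_scope.

(* The number of admissible paths to (a, j x + t, c), for 0 <= t <= x; it is meaningful for
   c <= j < a <= 4 only.  The entries solve the difference equation [block_poly_step] with
   the initial values [block_poly_glue] and [block_poly_corner]. *)
Definition block_poly (j a c : nat) (t x : rat) : rat :=
  match j, a, c with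
  | 0, 1, 0 => 1
  | 0, 2, 0 => t + 1
  | 0, 3, 0 => (t ^+ 2 + 3 * t + 2) / 2
  | 0, 4, 0 => (t ^+ 3 + 6 * t ^+ 2 + 11 * t + 6) / 6
  | 1, 2, 0 => x + 1
  | 1, 3, 0 => ((2 * x + 2) * t + x ^+ 2 + 3 * x + 2) / 2
  | 1, 4, 0 =>
      ((3 * x + 3) * t ^+ 2 + (3 * x ^+ 2 + 12 * x + 9) * t + x ^+ 3 + 6 * x ^+ 2 +
      11 * x + 6) / 6
  | 1, 2, 1 => (x + 1) * t + x + 2
  | 1, 3, 1 =>
      ((2 * x + 2) * t ^+ 2 + (x ^+ 2 + 7 * x + 8) * t + x ^+ 2 + 5 * x + 6) / 2
  | 1, 4, 1 =>
      ((3 * x + 3) * t ^+ 3 + (3 * x ^+ 2 + 21 * x + 21) * t ^+ 2 + (x ^+ 3 +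
      12 * x ^+ 2 + 44 * x + 42) * t + x ^+ 3 + 9 * x ^+ 2 + 26 * x + 24) / 6
  | 2, 3, 0 => (3 * x ^+ 2 + 5 * x + 2) / 2
  | 2, 4, 0 =>
      ((9 * x ^+ 2 + 15 * x + 6) * t + 7 * x ^+ 3 + 21 * x ^+ 2 + 20 * x + 6) / 6
  | 2, 3, 1 =>
      ((3 * x ^+ 2 + 5 * x + 2) * t + 3 * x ^+ 3 + 10 * x ^+ 2 + 13 * x + 6) / 2
  | 2, 4, 1 =>
      ((9 * x ^+ 2 + 15 * x + 6) * t ^+ 2 + (16 * x ^+ 3 + 60 * x ^+ 2 + 74 * x +
      30) * t + 7 * x ^+ 4 + 37 * x ^+ 3 + 74 * x ^+ 2 + 68 * x + 24) / 6
  | 2, 3, 2 =>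
      ((3 * x ^+ 2 + 5 * x + 2) * t ^+ 2 + (6 * x ^+ 3 + 23 * x ^+ 2 + 31 * x + 14) * t
      + 6 * x ^+ 3 + 24 * x ^+ 2 + 34 * x + 20) / 4
  | 2, 4, 2 =>
      ((9 * x ^+ 2 + 15 * x + 6) * t ^+ 3 + (25 * x ^+ 3 + 108 * x ^+ 2 + 143 * x +
      60) * t ^+ 2 + (14 * x ^+ 4 + 117 * x ^+ 3 + 319 * x ^+ 2 + 366 * x + 162) * t +
      14 * x ^+ 4 + 92 * x ^+ 3 + 220 * x ^+ 2 + 238 * x + 108) / 12
  | 3, 4, 0 => (8 * x ^+ 3 + 18 * x ^+ 2 + 13 * x + 3) / 3
  | 3, 4, 1 =>
      ((8 * x ^+ 3 + 18 * x ^+ 2 + 13 * x + 3) * t + 16 * x ^+ 4 + 56 * x ^+ 3 +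
      77 * x ^+ 2 + 49 * x + 12) / 3
  | 3, 4, 2 =>
      ((8 * x ^+ 3 + 18 * x ^+ 2 + 13 * x + 3) * t ^+ 2 + (32 * x ^+ 4 + 120 * x ^+ 3 +
      172 * x ^+ 2 + 111 * x + 27) * t + 24 * x ^+ 5 + 127 * x ^+ 4 + 280 * x ^+ 3 +
      323 * x ^+ 2 + 200 * x + 54) / 6
  | 3, 4, 3 =>
      ((16 * x ^+ 3 + 36 * x ^+ 2 + 26 * x + 6) * t ^+ 3 + (96 * x ^+ 4 + 384 * x ^+ 3 +
      570 * x ^+ 2 + 372 * x + 90) * t ^+ 2 + (144 * x ^+ 5 + 858 * x ^+ 4 +
      2048 * x ^+ 3 + 2472 * x ^+ 2 + 1546 * x + 408) * t + 144 * x ^+ 5 + 843 * x ^+ 4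
      + 1986 * x ^+ 3 + 2451 * x ^+ 2 + 1632 * x + 504) / 36
  | _, _, _ => 0
  end.

(** Counterpart of [walks_rec]. For [a = j] the first summand is the default value 0, in agreement
    with the inadmissible points where [b > a K]. *)
Lemma block_poly_step j a c t x : (j <= a < 4)%N -> (c <= j)%N ->
  block_poly j a.+1 c (t + 1) x =
    block_poly j a c (t + 1) x + block_poly j a.+1 c t x +
    (if c is c'.+1 then block_poly j a.+1 c' (t + 1) x else 0).
Proof.
case: j => [|[|[|[|j]]]]; case: a => [|[|[|[|a]]]] //;
  by case: c => [|[|[|[|c]]]] //= _ _; field.
Qed.

(** The end of block [j] and the start of block [j + 1] are the same point. *)
Lemma block_poly_glue j a c x : (j < 3)%N -> (j.+1 < a <= 4)%N -> (c <= j)%N ->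
  block_poly j.+1 a c 0 x = block_poly j a c x x.
Proof.
case: j => [|[|[|j]]]; case: a => [|[|[|[|[|a]]]]] //;
  by case: c => [|[|[|c]]] //= _ _ _; field.
Qed.

(** Counterpart of [walks_corner]: it supplies the initial value for the third coordinate [j + 1],
    which block [j] does not cover. *)
Lemma block_poly_corner j a x : (j < 3)%N -> (j.+1 < a <= 4)%N ->
  block_poly j.+1 a j.+1 0 x = \sum_(j.+1 <= i < a.+1) block_poly j i j x x.
Proof.
case: j => [|[|[|j]]]; case: a => [|[|[|[|[|a]]]]] //= _ _;
  by rewrite unlock /=; field.
Qed.

(** * Path counts agree with the block polynomials *)

Section BlockCounts.

Variable K : nat.

Local Notation W a b c := ((walks K (a + b + c) a b c)%:R : rat).

Lemma walks_inadmissible a b c : ~~ admissible K a b c -> W a b c = 0.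
Proof.
case e : (a + b + c)%N => [|n] /= => [|/negPf-> //].
by case: a b c e => [|a] [|b] [|c].
Qed.

Lemma walks_rec a b c : admissible K a.+1 b.+1 c ->
  W a.+1 b.+1 c = W a b.+1 c + W a.+1 b c + (if c is c'.+1 then W a.+1 b.+1 c' else 0).
Proof.
move=> /= ->; case: c => [|c]; rewrite ?addnS ?addSn /= !natrD //.
Qed.

Lemma walks_first_row a : W a 0 0 = 1.
Proof.
elim: a => [|a IHa] //; rewrite -[RHS]IHa !addn0 /=.
by rewrite /admissible ?leq0n /= !addn0.
Qed.

Hypothesis K_gt0 : (0 < K)%N.

(** At height [c = j + 1] the point with [b] one smaller is inadmissible. Hence a path ends with a
    third-row step taken at some first coordinate [i], followed by first-row steps only. *)
Lemma walks_corner a j : W a (j.+1 * K)%N j.+1 = \sum_(j.+1 <= i < a.+1) W i (j.+1 * K)%N j.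
Proof.
elim: a => [|a IHa].
  by rewrite big_geq // walks_inadmissible // /admissible !andbF.
have [ja|aj] := leqP j a; last first.
  rewrite big_geq // walks_inadmissible //.
  by rewrite /admissible [(j < a.+1)%N]ltnNge aj !andbF.
rewrite big_nat_recr //= -IHa.
have [b bE] : exists b, (j.+1 * K)%N = b.+1.
  by exists (j.+1 * K).-1; rewrite prednK // muln_gt0.
rewrite bE walks_rec; last first.
  by rewrite /admissible -bE !leq_mul2r ltnS ja leqnn orbT.
by rewrite [X in _ + X + _]walks_inadmissible ?addr0 // /admissible bE ltnn andbF.
Qed.

Local Notation block j a c t := (block_poly j a c t%:R K%:R).

Lemma block_poly_diag j c t x : (j < 4)%N -> block_poly j j c t x = 0.
Proof. by case: j => [|[|[|[|j]]]]. Qed.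

(** Both sides obey the same recurrence, so agreement at [t = 0] propagates through the block by
    induction on [a + c + t]. *)
Lemma walks_in_block j : (j < 4)%N ->
  (forall a c, (j < a <= 4)%N -> (c <= j)%N -> W a (j * K)%N c = block j a c 0) ->
  forall a c t, (j < a <= 4)%N -> (c <= j)%N -> (t <= K)%N ->
    W a (j * K + t)%N c = block j a c t.
Proof.
move=> j4 start a c t; have [n] := ubnP (a + c + t).
elim: n a c t => // n IHn [|a] c [|t] // le_n ja cj tK.
  by rewrite [(_ + 0)%N]addn0 start.
have [lja a4] := andP ja.
rewrite addnS walks_rec; last first.
  rewrite /admissible (leq_trans cj (ltnW lja)) andbT -addnS; apply/andP; split.
    apply: (@leq_trans (j.+1 * K)); first by rewrite mulSn addnC leq_add2r.
    by rewrite leq_mul2r lja orbT.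
  by apply: leq_trans (leq_addr _ _); rewrite leq_mul2r cj orbT.
rewrite -natr1 block_poly_step //.
rewrite IHn // ?(ltnW tK) //; last by lia.
rewrite -addnS natr1; congr (_ + _ + _).
  have [ltja|aj] := ltnP j a; first by rewrite IHn // ?(ltnW a4) ?ltja //; lia.
  have -> : a = j by lia.
  rewrite block_poly_diag // walks_inadmissible // /admissible.
  by rewrite addnS ltnNge leq_addr.
case: c {le_n} cj (le_n) => // c cj le_n.
by rewrite IHn //; lia.
Qed.

(** Induction on the block: block 0 starts with the value 1, and a later block starts by gluing when
    [c] is below the block index and by the corner sum when it equals it. *)
Lemma walks_blocks j a c t : (j < 4)%N -> (j < a <= 4)%N -> (c <= j)%N -> (t <= K)%N ->
  W a (j * K + t)%N c = block j a c t.
Proof.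
elim: j a c t => [|j IHj] a c t j4; apply: walks_in_block => // {t} {}a {}c /andP[ja a4].
  rewrite leqn0 mul0n => /eqP ->; rewrite walks_first_row.
  by case: a ja a4 => [|[|[|[|[|]]]]] //= _ _; field.
rewrite leq_eqVlt => /predU1P[->|cj]; last first.
  by rewrite block_poly_glue ?ja // -IHj // 1?mulSnr ?(ltnW ja) // ltnW.
rewrite walks_corner block_poly_corner ?ja //.
apply: eq_big_nat => i /andP[ji ia]; rewrite mulSnr IHj ?ji ?(ltnW j4) //.
exact: leq_trans a4.
Qed.

(** The corner sum has a single term here: the last step is a third-row step from the end of block
    3. *)
Lemma walks_full : W 4 (4 * K)%N 4 = block_poly 3 4 3 K%:R K%:R.
Proof. by rewrite walks_corner big_nat1 mulSnr walks_blocks. Qed.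

End BlockCounts.

Theorem proposition3p5 (k : nat) (hk : (1 <= k)%N) :
  (catalan3 k 4)%:R =
    (256 * k%:R ^+ 6 - 114 * k%:R ^+ 5 + 217 * k%:R ^+ 4
       - 12 * k%:R ^+ 3 + 121 * k%:R ^+ 2) / 36 + 1 :> rat.
Proof.
rewrite catalan3_walks; case: k hk => // -[|k] _.
  (* For [k = 1] we have [K = 0] and there are no blocks; the count is the Catalan number 14 of
     standard tableaux with two rows of length 4, found by evaluation. *)
  by rewrite (_ : walks _ _ _ _ _ = 14) //; field.
(* Here [K = k.+1]; writing [k.+2] as [K + 1] leaves a polynomial identity in [K]. *)
by rewrite subn1 /= (walks_full (ltn0Sn k)) -[k.+2%:R]natr1 /=; field.
Qed.
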